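(* Let $\phi$ be a formula in the language of $\mathbf{PT}_0$ whose propositional variables are among $p_{i_1},\dots,p_{i_n}$ (with $n\geq 1$ and $i_1,\dots,i_n$ distinct). Then $\phi$ is semantically equivalent to a formula in the language of $\mathbf{PD}^{\vee}$ of the form (disjunctive normal form) $$\bigvee_{f\in F}\ \bigotimes_{s\in X_f}\bigl(p_{i_1}^{s(i_1)}\wedge\dots\wedge p_{i_n}^{s(i_n)}\bigr),$$ and also to a formula in the language of $\mathbf{InqL}$ (hence of $\mathbf{PID}$) of the form (disjunctive-negative normal form) $$\bigvee_{f\in F}\ \neg\neg\bigvee_{s\in X_f}\bigl(p_{i_1}^{s(i_1)}\wedge\dots\wedge p_{i_n}^{s(i_n)}\bigr),$$ where $F$ is a nonempty finite set of indices and each $X_f$ is a team on $\{i_1,\dots,i_n\}$.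
   Context: Propositional variables are $p_i$, $i\in\mathbb{N}$. A valuation is a function $s:\mathbb{N}\to\{0,1\}$; a team is a set of valuations. A team on a finite set $N\subseteq\mathbb{N}$ is a set of functions $N\to\{0,1\}$. Formulas of $\mathbf{PT}_0$ are given by $$\phi::=p_i\mid\neg p_i\mid\bot\mid\mathop{=}(p_{i_1},\dots,p_{i_k},p_j)\mid(\phi\wedge\phi)\mid(\phi\otimes\phi)\mid(\phi\vee\phi)\mid(\phi\to\phi),$$ where $k\ge 0$. Truth on a team $X$ is defined by: - $X\models p_i$ iff $s(i)=1$ for all $s\in X$; $X\models\neg p_i$ iff $s(i)=0$ for all $s\in X$; $X\models\bot$ iff $X=\emptyset$; - $X\models\mathop{=}(p_{i_1},\dots,p_{i_k},p_j)$ iff for all $s,s'\in X$, if $s(i_1)=s'(i_1),\dots,s(i_k)=s'(i_k)$ then $s(j)=s'(j)$; - $X\models\phi\wedge\psi$ iff $X\models\phi$ and $X\models\psi$; - $X\models\phi\otimes\psi$ iff there are $Y,Z\subseteq X$ with $X=Y\cup Z$, $Y\models\phi$ and $Z\models\psi$; - $X\models\phi\vee\psi$ iff $X\models\phi$ or $X\models\psi$; - $X\models\phi\to\psi$ iff for all $Y\subseteq X$, $Y\models\phi$ implies $Y\models\psi$. For arbitrary $\phi$, $\neg\phi$ abbreviates $\phi\to\bot$ (on a variable this has the same semantics as the atom $\neg p_i$, and in $\mathbf{InqL}$ and $\mathbf{PID}$ the formula $\neg p_i$ is read as $p_i\to\bot$). Formulas are semantically equivalent if they are true on the same teams. $\mathbf{PD}^{\vee}$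 has atoms $p_i,\neg p_i,\bot$ and connectives $\wedge,\otimes,\vee$. $\mathbf{InqL}$ has atoms $p_i,\bot$ and connectives $\wedge,\vee,\to$. $\mathbf{PID}$ has in addition to $\mathbf{InqL}$ the dependence atoms. Notation: $p_i^1:=p_i$, $p_i^0:=\neg p_i$. When $X_f=\emptyset$, both $\bigotimes_{s\in X_f}(\dots)$ and $\neg\neg\bigvee_{s\in X_f}(\dots)$ stand for $\bot$. *)

(* Defs.v *)
From mathcomp Require Import all_boot.
From mathcomp Require Import classical_sets.

Set Implicit Arguments.
Unset Strict Implicit.
Unset Printing Implicit Defensive.

Local Open Scope classical_set_scope.

Definition valuation := nat -> bool.
Definition team := set valuation.

(* Formulas of PT_0; the other languages are the syntactic fragments below. *)
Inductive form : Type :=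
| Var of nat
| NegVar of nat
| Bot
| Dep of seq nat & nat
| And of form & form
| Tensor of form & form
| Or of form & form
| Imp of form & form.

Definition Neg (phi : form) : form := Imp phi Bot.

Fixpoint sat (X : team) (phi : form) {struct phi} : Prop :=
  match phi with
  | Var i => forall s, X s -> s i = true
  | NegVar i => forall s, X s -> s i = false
  | Bot => X = set0
  | Dep ks j => forall s s', X s -> X s' ->
      (forall k, k \in ks -> s k = s' k) -> s j = s' j
  | And phi psi => sat X phi /\ sat X psi
  | Tensor phi psi => exists Y Z : team,
      [/\ Y `<=` X, Z `<=` X, X = Y `|` Z, sat Y phi & sat Z psi]
  | Or phi psi => sat X phi \/ sat X psi
  | Imp phi psi => forall Y : team, Y `<=` X -> sat Y phi -> sat Y psi
  end.

Definition sem_equiv (phi psi : form) : Prop :=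
  forall X : team, sat X phi <-> sat X psi.

Fixpoint vars (phi : form) : seq nat :=
  match phi with
  | Var i | NegVar i => [:: i]
  | Bot => [::]
  | Dep ks j => rcons ks j
  | And phi psi | Tensor phi psi | Or phi psi | Imp phi psi =>
      vars phi ++ vars psi
  end.

Fixpoint in_PDvee (phi : form) : bool :=
  match phi with
  | Var _ | NegVar _ | Bot => true
  | And phi psi | Tensor phi psi | Or phi psi => in_PDvee phi && in_PDvee psi
  | Dep _ _ | Imp _ _ => false
  end.

(* [NegVar] is excluded from InqL and PID: there, the negation of a variable is
   [Neg (Var i)]. *)
Fixpoint in_InqL (phi : form) : bool :=
  match phi with
  | Var _ | Bot => true
  | And phi psi | Or phi psi | Imp phi psi => in_InqL phi && in_InqL psi
  | NegVar _ | Dep _ _ | Tensor _ _ => false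
  end.

Fixpoint in_PID (phi : form) : bool :=
  match phi with
  | Var _ | Bot | Dep _ _ => true
  | And phi psi | Or phi psi | Imp phi psi => in_PID phi && in_PID psi
  | NegVar _ | Tensor _ _ => false
  end.

(* A team on the finite set of the entries of [N]. *)
Definition team_on (N : seq nat) : Type := {set {ffun seq_sub N -> bool}}.

(* Left-nested iteration x1 op x2 op ... op xm, without a trailing unit; the
   empty iteration stands for [Bot]. *)
Definition big_form (op : form -> form -> form) (l : seq form) : form :=
  if l is x :: l' then foldl op x l' else Bot.

Definition lit_PDvee (i : nat) (b : bool) : form :=
  if b then Var i else NegVar i.

Definition lit_InqL (i : nat) (b : bool) : form :=
  if b then Var i else Neg (Var i).

Section NormalForms.

Variables (n : nat) (idx : n.-tuple nat).

(* p_{i_1}^{s(i_1)} /\ ... /\ p_{i_n}^{s(i_n)}, with [lit i b] read as p_i^b. *)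
Definition state_form (lit : nat -> bool -> form)
    (s : {ffun seq_sub idx -> bool}) : form :=
  big_form And
    [seq lit (tnth idx k) (s (SeqSub (mem_tnth k idx))) | k <- enum 'I_n].

Definition tensor_states (Y : team_on idx) : form :=
  big_form Tensor [seq state_form lit_PDvee s | s <- enum Y].

(* For the empty team the whole formula, double negation included, is [Bot]. *)
Definition negneg_states (Y : team_on idx) : form :=
  if Y == finset.set0 then Bot
  else Neg (Neg (big_form Or [seq state_form lit_InqL s | s <- enum Y])).

Definition disj_nf (F : finType) (X : F -> team_on idx) : form :=
  big_form Or [seq tensor_states (X f) | f <- enum F].

Definition disj_neg_nf (F : finType) (X : F -> team_on idx) : form :=
  big_form Or [seq negneg_states (X f) | f <- enum F].

End NormalForms.

(* Main.v *)
Require Import Defs.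
From mathcomp Require Import all_boot.
From mathcomp Require Import boolp classical_sets.

(** Truth of a formula on a team depends only on the restrictions of the
    valuations of the team to the variables of the formula, and is inherited by
    teams with fewer restrictions. Hence a formula is determined by the finitely
    many teams [Y] on its variables whose full lift to valuations satisfies it:
    it holds on [X] iff all restrictions of elements of [X] lie in one such [Y].
    The formulas [tensor_states Y] and [negneg_states Y] both express this
    inclusion; the index set is nonempty because every formula holds on the
    empty team. *)

Set Implicit Arguments.
Unset Strict Implicit.
Unset Printing Implicit Defensive.

Local Open Scope classical_set_scope.

(** * Empty team property, locality and downward closure *)

Lemma sat_set0 phi : sat set0 phi.
Proof.
elim: phi => //=.
- by move=> phi1 IH1 phi2 IH2; exists set0, set0; rewrite setU0; split.
- by move=> phi1 IH1 phi2 IH2; left.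
- by move=> phi1 IH1 phi2 IH2 Y; rewrite subset0 => ->.
Qed.

Definition restr (N : seq nat) (s : valuation) : {ffun seq_sub N -> bool} :=
  [ffun k => s (ssval k)].

Lemma restr_eqP (N : seq nat) (s s' : valuation) :
  restr N s = restr N s' <-> {in N, s =1 s'}.
Proof.
split=> [E i iN | E].
  by have /ffunP/(_ (SeqSub iN)) := E; rewrite !ffunE.
by apply/ffunP => -[i iN]; rewrite !ffunE /= E.
Qed.

(** Locality and downward closure are proved as one statement. Between teams with the same
    restrictions the induction hypothesis then works in both directions, which the implication case
    needs. *)
Lemma sat_restr (N : seq nat) phi (X Y : team) :
    {subset vars phi <= N} -> restr N @` Y `<=` restr N @` X ->
  sat X phi -> sat Y phi.
Proof.
move=> + YX; have {}YX y : Y y -> exists2 x, X x & restr N x = restr N y.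
  by move=> Yy; apply: YX; exists y.
elim: phi X Y YX => /=
  [i|i||ks j|f IHf g IHg|f IHf g IHg|f IHf g IHg|f IHf g IHg] X Y YX vN.
- move=> sX y /YX[x Xx /restr_eqP <-]; [exact: sX | by apply: vN; rewrite inE].
- move=> sX y /YX[x Xx /restr_eqP <-]; [exact: sX | by apply: vN; rewrite inE].
- by move=> X0; rewrite -subset0 => y /YX[x]; rewrite X0.
- move=> sX y y' /YX[x Xx /restr_eqP xy] /YX[x' Xx' /restr_eqP xy'] yy'.
  have jN : j \in N by apply: vN; rewrite mem_rcons inE eqxx.
  rewrite -xy // -xy' //; apply: sX => // k kks.
  have kN : k \in N by apply: vN; rewrite mem_rcons inE kks orbT.
  by rewrite xy // xy' // yy'.
- have [vf vg] : {subset vars f <= N} /\ {subset vars g <= N}.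
    by split=> i iv; apply: vN; rewrite mem_cat iv ?orbT.
  by move=> [Xf Xg]; split; [exact: (IHf X) | exact: (IHg X)].
- have [vf vg] : {subset vars f <= N} /\ {subset vars g <= N}.
    by split=> i iv; apply: vN; rewrite mem_cat iv ?orbT.
  move=> [A [B [AX BX XE Af Bg]]].
  (* A cover of [X] by [A] and [B] is pulled back to [Y]: each half collects the members of [Y] that
     agree on [N] with some valuation in the corresponding half. *)
  pose part (C : team) :=
    [set y | Y y /\ exists2 x, C x & restr N x = restr N y].
  exists (part A), (part B); split=> [y []//|y []//|||].
  + apply/seteqP; split=> [y Yy | y [] []//].
    have [x] := YX _ Yy; rewrite XE => -[Ax|Bx] xy; [left|right];
      by split=> //; exists x.
  + by apply: (IHf A) => // y [].
  + by apply: (IHg B) => // y [].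
- have [vf vg] : {subset vars f <= N} /\ {subset vars g <= N}.
    by split=> i iv; apply: vN; rewrite mem_cat iv ?orbT.
  by move=> [Xf|Xg]; [left; exact: (IHf X) | right; exact: (IHg X)].
- have [vf vg] : {subset vars f <= N} /\ {subset vars g <= N}.
    by split=> i iv; apply: vN; rewrite mem_cat iv ?orbT.
  move=> sX Z ZY Zf.
  (* [X'] and [Z] have the same restrictions, so the hypothesis for [f] goes from [Z] to [X'] and
     the one for [g] comes back. *)
  pose X' : team := [set x | X x /\ exists2 z, Z z & restr N z = restr N x].
  apply: (IHg X') => //.
    move=> z Zz; have [x Xx xz] := YX _ (ZY _ Zz).
    by exists x => //; split=> //; exists z.
  by apply: sX => [x []//|]; apply: (IHf Z) => // x [].
Qed.

Lemma sat_subset phi (X Y : team) : Y `<=` X -> sat X phi -> sat Y phi.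
Proof.
by move=> YX; apply: (@sat_restr (vars phi)) => //; exact: image_subset.
Qed.

(** By downward closure, if [[set s]] fails [phi] then only its empty subteam satisfies [phi], so
    [[set s]] satisfies the negation and the double negation forces it to be empty. Conversely, a
    member [y] of a team satisfying the negation would make [[set y]] satisfy [phi] and hence be
    empty. *)
Lemma sat_Neg_Neg phi (X : team) :
  sat X (Neg (Neg phi)) <-> forall s, X s -> sat [set s] phi.
Proof.
split=> /= [nnX s Xs | sX Y YX nY].
  apply: contrapT => ns.
  suff /seteqP[/(_ s erefl)] : [set s] = set0 by [].
  apply: nnX => [_ -> //|Z Zs Zphi].
  rewrite -subset0 => z Zz; apply: ns.
  apply: sat_subset Zphi => _ ->.
  by have <- : z = s by exact: Zs.
rewrite -subset0 => y Yy.
have /seteqP[/(_ y erefl)] // : [set y] = set0.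
by apply: nY (sX y (YX y Yy)) => _ ->.
Qed.

(** * Iterated connectives *)

Lemma in_big_form (L : form -> bool) (op : form -> form -> form) l :
    L Bot -> (forall phi psi, L (op phi psi) = L phi && L psi) ->
  L (big_form op l) = all L l.
Proof.
move=> LB Lop; case: l => //= a l.
by elim: l a => [|b l IH] a /=; rewrite ?andbT // IH Lop andbA.
Qed.

Section BigForm.

Variables (T : eqType) (f : T -> form).
Implicit Types (l : seq T) (X : team).

Lemma sat_big_And l X : l != [::] ->
  sat X (big_form And (map f l)) <-> {in l, forall x, sat X (f x)}.
Proof.
case: l => //= a l _.
have -> : {in a :: l, forall x, sat X (f x)} <->
    sat X (f a) /\ {in l, forall x, sat X (f x)}.
  split=> [Xl|[Xa Xl] x]; last by rewrite inE => /predU1P[->|/Xl].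
  split=> [|x xl]; apply: Xl; first by rewrite inE eqxx.
  by rewrite inE xl orbT.
elim: l (f a) => [|b l IH] psi /=; first by split=> [|[]].
rewrite IH /=; split=> [[[Xa Xb] Xl]|[Xa Xl]].
  by split=> // x; rewrite inE => /predU1P[->|/Xl].
split=> [|x xl]; last by apply: Xl; rewrite inE xl orbT.
by split=> //; apply: Xl; rewrite inE eqxx.
Qed.

Lemma sat_big_Or l X : l != [::] ->
  sat X (big_form Or (map f l)) <-> exists2 x, x \in l & sat X (f x).
Proof.
case: l => //= a l _.
have -> : (exists2 x, x \in a :: l & sat X (f x)) <->
    sat X (f a) \/ exists2 x, x \in l & sat X (f x).
  split=> [[x]|[Xa|[x xl Xx]]].
  - by rewrite inE => /predU1P[->|xl Xx]; [left|right; exists x].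
  - by exists a => //; rewrite inE eqxx.
  - by exists x => //; rewrite inE xl orbT.
elim: l (f a) => [|b l IH] psi /=; first by split=> [|[|[]]//]; left.
rewrite IH /=; split=> [[[Xa|Xb]|[x xl Xx]]|[Xa|[x]]].
- by left.
- by right; exists b => //; rewrite inE eqxx.
- by right; exists x => //; rewrite inE xl orbT.
- by left; left.
- by rewrite inE => /predU1P[->|xl Xx]; [left; right|right; exists x].
Qed.

(** Each [f x] is flat: it is tested valuation by valuation, through [P x]. Flatness survives
    tensors, because a team can be split according to which property its members have. *)
Lemma sat_big_Tensor (P : T -> valuation -> Prop) l X :
    (forall x Y, sat Y (f x) <-> forall s, Y s -> P x s) ->
  sat X (big_form Tensor (map f l)) <->
  forall s, X s -> exists2 x, x \in l & P x s.
Proof.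
move=> f_flat; case: l => [|a l] /=.
  split=> [-> //|X0]; rewrite -subset0 => s /X0[] //.
(* The left-nested fold accumulates in its head, so the induction is over an arbitrary flat head
   [psi]. *)
have step psi (Q : valuation -> Prop)
    (psi_flat : forall Y, sat Y psi <-> forall s, Y s -> Q s) :
    sat X (foldl Tensor psi (map f l)) <->
    forall s, X s -> Q s \/ exists2 x, x \in l & P x s.
  elim: l psi Q psi_flat => [|b l IH] psi Q psi_flat /=.
    by rewrite psi_flat; split=> sX s /sX; [left | case=> [|[]]].
  rewrite (IH _ (fun s => Q s \/ P b s)) => [|Y /=].
    split=> sX s /sX.
      move=> [[Qs|Ps]|[x xl Px]]; [by left | right..].
        by exists b => //; rewrite inE eqxx.
      by exists x => //; rewrite inE xl orbT.
    move=> [Qs|[x]]; first by left; left.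
    by rewrite inE => /predU1P[->|xl Px]; [left; right | right; exists x].
  split=> [[A [B [_ _ ->]]]|QP].
    by rewrite psi_flat f_flat => QA PB s [/QA|/PB]; [left | right].
  exists [set s | Y s /\ Q s], [set s | Y s /\ P b s].
  split=> [s []//|s []//|||]; last 2 first.
  - by apply/psi_flat => s [].
  - by apply/f_flat => s [].
  apply/seteqP; split=> [s Ys|s [[]|[]]//].
  by have [] := QP s Ys; [left | right].
rewrite (step _ (P a)) //; split=> sX s /sX.
  move=> [Ps|[x xl Px]]; first by exists a => //; rewrite inE eqxx.
  by exists x => //; rewrite inE xl orbT.
by move=> [x]; rewrite inE => /predU1P[->|xl Px]; [left | right; exists x].
Qed.

End BigForm.

(** * Truth of the two normal forms *)

Section NormalFormSemantics.

Variables (n : nat) (idx : n.-tuple nat).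
Hypothesis n_gt0 : 0 < n.

Lemma sat_state_form (lit : nat -> bool -> form) t (X : team) :
    (forall i b Y, sat Y (lit i b) <-> forall s, Y s -> s i = b) ->
  sat X (@state_form n idx lit t) <-> forall s, X s -> restr idx s = t.
Proof.
move=> lit_flat; rewrite /state_form sat_big_And; last first.
  (* An empty conjunction would be [Bot]; [n_gt0] rules this out. *)
  by rewrite -size_eq0 size_enum_ord -lt0n.
split=> [sX s Xs | sX k _].
  apply/ffunP => -[i iidx]; rewrite ffunE /=.
  have /tnthP[k ik] := iidx.
  have -> : SeqSub iidx = SeqSub (mem_tnth k idx) by apply: val_inj.
  by rewrite ik; have /lit_flat := sX k (mem_enum _ k); exact.
by apply/lit_flat => s /sX <-; rewrite ffunE.
Qed.

Lemma sat_lit_PDvee i b (X : team) :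
  sat X (lit_PDvee i b) <-> forall s, X s -> s i = b.
Proof. by case: b. Qed.

Lemma sat_lit_InqL i b (X : team) :
  sat X (lit_InqL i b) <-> forall s, X s -> s i = b.
Proof.
case: b => //=; split=> [nX s Xs | X0 Y YX Yi].
  apply/negbTE/negP => si.
  (* If [s i] were true, the subteam [[set s]] would satisfy [Var i] and so be empty. *)
  have /seteqP[/(_ s erefl)] // : [set s] = set0.
  by apply: nX => _ ->.
by rewrite -subset0 => s Ys; have := Yi s Ys; rewrite X0 //; exact: YX.
Qed.

Lemma sat_tensor_states (Y : team_on idx) (X : team) :
  sat X (tensor_states Y) <-> forall s, X s -> restr idx s \in Y.
Proof.
rewrite (sat_big_Tensor (P := fun t s => restr idx s = t)); last first.
  by move=> t Z; exact: sat_state_form sat_lit_PDvee.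
split=> sX s /sX; first by move=> [t]; rewrite mem_enum => tY ->.
by move=> sY; exists (restr idx s); rewrite ?mem_enum.
Qed.

Lemma sat_negneg_states (Y : team_on idx) (X : team) :
  sat X (negneg_states Y) <-> forall s, X s -> restr idx s \in Y.
Proof.
rewrite /negneg_states; have [->|Y0] := eqVneq.
  by split=> [-> //|X0]; rewrite /= -subset0 => s /X0; rewrite inE.
have {}Y0 : enum Y != [::] by rewrite -size_eq0 -cardE cards_eq0.
(* The disjunction alone would force one common restriction on all of [X]; the double negation asks
   for it only on singletons, where it just says that the restriction lies in [Y]. *)
rewrite sat_Neg_Neg; split=> sX s /sX; rewrite sat_big_Or //.
- move=> [t]; rewrite mem_enum => tY.
  by rewrite (sat_state_form _ _ sat_lit_InqL) => ->.
- move=> sY; exists (restr idx s); rewrite ?mem_enum //.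
  by rewrite (sat_state_form _ _ sat_lit_InqL) => _ ->.
Qed.

Variable phi : form.
Hypothesis vars_phi : {subset vars phi <= idx}.

Definition full_team (Y : {set {ffun seq_sub idx -> bool}}) : team :=
  [set s | restr idx s \in Y].

(** Made boolean by classical decidability, so that the sets satisfying it form a finite type that
    can index the disjunction. *)
Definition supporting : pred {set {ffun seq_sub idx -> bool}} :=
  fun Y => `[< sat (full_team Y) phi >].

Definition supporting_set0 : {Y | supporting Y}.
Proof.
exists finset.set0; apply/asboolP.
suff -> : full_team finset.set0 = set0 by exact: sat_set0.
by rewrite -subset0 => s; rewrite /full_team /= inE.
Defined.

Lemma sem_equiv_supporting (g : team_on idx -> form) :
    (forall Y X, sat X (g Y) <-> forall s, X s -> restr idx s \in Y) ->
  sem_equiv phi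
    (big_form Or [seq g (val Y) | Y <- enum {: {Y | supporting Y}}]).
Proof.
move=> gE X; rewrite sat_big_Or; last first.
  by rewrite -size_eq0 -cardE -lt0n; apply/card_gt0P; exists supporting_set0.
split=> [Xphi|[[Y sY] _ /gE XY]]; last first.
  by have /asboolP := sY; apply: sat_subset => s /XY.
(* The disjunct is chosen by the restrictions of [X] itself: the full lift of this [Y] has no
   further restrictions, so [sat_restr] carries [phi] over to it. *)
pose Y : {set {ffun seq_sub idx -> bool}} :=
  [set t | `[< (restr idx @` X) t >]]%SET.
have sY : supporting Y.
  apply/asboolP; apply: (sat_restr vars_phi _ Xphi) => _ [s Ys <-].
  by move: Ys; rewrite /full_team /= inE => /asboolP.
exists (exist _ Y sY); first by rewrite mem_enum.
by apply/gE => s Xs; rewrite inE; apply/asboolP; exists s.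
Qed.

End NormalFormSemantics.

(** * Membership in the syntactic fragments *)

Lemma in_InqL_PID phi : in_InqL phi -> in_PID phi.
Proof.
by elim: phi => //= phi1 IH1 phi2 IH2 /andP[/IH1 -> /IH2 ->].
Qed.

Section Languages.

Variables (n : nat) (idx : n.-tuple nat) (F : finType) (X : F -> team_on idx).

Lemma in_PDvee_disj_nf : in_PDvee (disj_nf X).
Proof.
rewrite in_big_form // all_map; apply/allP => f _ /=.
rewrite in_big_form // all_map; apply/allP => t _ /=.
rewrite in_big_form // all_map; apply/allP => k _ /=.
by rewrite /lit_PDvee; case: ifP.
Qed.

Lemma in_InqL_disj_neg_nf : in_InqL (disj_neg_nf X).
Proof.
rewrite in_big_form // all_map; apply/allP => f _ /=.
rewrite /negneg_states; case: ifP => //= _; rewrite !andbT.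
rewrite in_big_form // all_map; apply/allP => t _ /=.
rewrite in_big_form // all_map; apply/allP => k _ /=.
by rewrite /lit_InqL; case: ifP.
Qed.

End Languages.

Theorem mainTheorem2 (phi : form) (n : nat) (idx : n.-tuple nat)
    (n_ge1 : 1 <= n) (idx_uniq : uniq idx)
    (vars_phi : {subset vars phi <= idx}) :
  exists (F : finType) (X : F -> team_on idx),
    [/\ 0 < #|F|,
        in_PDvee (disj_nf X) /\ sem_equiv phi (disj_nf X) &
        [/\ in_InqL (disj_neg_nf X), in_PID (disj_neg_nf X)
          & sem_equiv phi (disj_neg_nf X)]].
Proof.
exists {Y | @supporting n idx phi Y}, val; split.
- by apply/card_gt0P; exists (supporting_set0 idx phi).
- split; first exact: in_PDvee_disj_nf.
  exact (sem_equiv_supporting vars_phi (sat_tensor_states n_ge1)).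
- split; first exact: in_InqL_disj_neg_nf.
    exact/in_InqL_PID/in_InqL_disj_neg_nf.
  exact (sem_equiv_supporting vars_phi (sat_negneg_states n_ge1)).
Qed.
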